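(* If $\mathcal{M}$ is an $\omega_1$-like model of Peano Arithmetic, then the real closure $R(\mathcal{M})$ is not resplendent.
   Context: A model $\mathcal{M}$ of Peano Arithmetic (PA) is identified with the ordered ring whose nonnegative elements form that model; $R(\mathcal{M})$ denotes the real closure of (the fraction field of) this ordered ring. A linear order is $\omega_1$-like if it is uncountable but every proper initial segment is countable; a model of PA is $\omega_1$-like if the order on its nonnegative elements is. A structure $\mathcal{K}$ in a finite language $L$ is resplendent if for every finite language $L^*\supset L$, every recursive $L^*$-theory $T(\bar w)$ with free variables $\bar w=(w_1,\dots,w_k)$, and every tuple $\bar a\in \mathcal{K}^k$, if $T(\bar a)\cup \mathrm{Th}(\mathcal{K},\bar a)$ is consistent, then there is an expansion of $\mathcal{K}$ to an $L^*$-structure $\mathcal{K}^*$ with $(\mathcal{K}^*,\bar a)\models T(\bar w)$. Here $R(\mathcal{M})$ is considered in the language of ordered fields. *)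

(* Defs.v *)
From HB Require Import structures.
From mathcomp Require Import all_boot all_order all_algebra.
From mathcomp Require Import boolp classical_sets functions cardinality.

Set Implicit Arguments.
Unset Strict Implicit.
Unset Printing Implicit Defensive.

Import Order.TTheory GRing.Theory Num.Theory.
Local Open Scope classical_set_scope.
Local Open Scope ring_scope.

(* Finite sequences of length n are functions on 'I_n, as the rows of a      *)
(* matrix are: this makes terms below an ordinary inductive type.            *)
Definition scons (T : Type) n (a : T) (v : 'I_n -> T) : 'I_n.+1 -> T :=
  fun i => oapp v a (unlift ord0 i).

Record language := Language {
  fsym : finType;
  fary : fsym -> nat;
  rsym : finType;
  rary : rsym -> nat }.

(* Terms and formulas whose free variables are among those indexed by 'I_n;  *)
(* variables are de Bruijn indices, All binding the variable ord0.           *)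
Inductive term (L : language) (n : nat) :=
| Var of 'I_n
| App (f : fsym L) (args : 'I_(fary f) -> term L n).

Inductive formula (L : language) : nat -> Type :=
| Bot n : formula L n
| Eq n of term L n & term L n : formula L n
| Rel n (r : rsym L) (args : 'I_(rary r) -> term L n) : formula L n
| Imp n of formula L n & formula L n : formula L n
| All n of formula L n.+1 : formula L n.

Arguments Var {L n} i.
Arguments App {L n} f args.
Arguments Bot {L n}.
Arguments Eq {L n} s t.
Arguments Rel {L n} r args.
Arguments Imp {L n} p q.
Arguments All {L n} p.

Definition Neg L n (p : formula L n) := Imp p Bot.
Definition And L n (p q : formula L n) := Neg (Imp p (Neg q)).
Definition Iff L n (p q : formula L n) := And (Imp p q) (Imp q p).
Definition Exi L n (p : formula L n.+1) : formula L n := Neg (All (Neg p)).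

Fixpoint tsubst L n m (s : 'I_n -> term L m) (t : term L n) : term L m :=
  match t with
  | Var i => s i
  | App f args => App f (fun i => tsubst s (args i))
  end.

Definition tshift L n : term L n -> term L n.+1 :=
  tsubst (fun i => Var (lift ord0 i)).

Definition under_binder L n m (s : 'I_n -> term L m) :
    'I_n.+1 -> term L m.+1 :=
  scons (Var ord0) (fun i => tshift (s i)).

Fixpoint fsubst L n (p : formula L n) :
    forall m, ('I_n -> term L m) -> formula L m :=
  match p with
  | Bot _ => fun m s => Bot
  | Eq _ t u => fun m s => Eq (tsubst s t) (tsubst s u)
  | Rel _ r args => fun m s => Rel r (fun i => tsubst s (args i))
  | Imp _ p q => fun m s => Imp (fsubst p s) (fsubst q s)
  | All _ p => fun m s => All (fsubst p (under_binder s))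
  end.

Definition fshift L n (p : formula L n) : formula L n.+1 :=
  fsubst p (fun i => Var (lift ord0 i)).

Definition finst L n (p : formula L n.+1) (t : term L n) : formula L n :=
  fsubst p (scons t Var).

Record structure (L : language) (D : Type) := Structure {
  ifun : forall f : fsym L, ('I_(fary f) -> D) -> D;
  irel : forall r : rsym L, ('I_(rary r) -> D) -> Prop }.

Fixpoint teval L D (S : structure L D) n (v : 'I_n -> D) (t : term L n) : D :=
  match t with
  | Var i => v i
  | App f args => ifun S (fun i => teval S v (args i))
  end.

Fixpoint sat L D (S : structure L D) n (p : formula L n) :
    ('I_n -> D) -> Prop :=
  match p with
  | Bot _ => fun v => False
  | Eq _ t u => fun v => teval S v t = teval S v u
  | Rel _ r args => fun v => irel S (fun i => teval S v (args i))
  | Imp _ p q => fun v => sat S p v -> sat S q v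
  | All _ p => fun v => forall d : D, sat S p (scons d v)
  end.

(* [provable G p] only uses finitely many of the hypotheses G; the free      *)
(* variables of G and p, which [prv_allI] does not generalize, play the part *)
(* of constants.                                                             *)
Inductive provable (L : language) :
    forall n, (formula L n -> Prop) -> formula L n -> Prop :=
| prv_hyp n (G : formula L n -> Prop) p : G p -> provable G p
| prv_impI n (G : formula L n -> Prop) p q :
    provable (fun r => G r \/ r = p) q -> provable G (Imp p q)
| prv_impE n (G : formula L n -> Prop) p q :
    provable G (Imp p q) -> provable G p -> provable G q
| prv_dne n (G : formula L n -> Prop) p :
    provable G (Neg (Neg p)) -> provable G p
| prv_allI n (G : formula L n -> Prop) (p : formula L n.+1) :
    provable (fun r => exists2 q, G q & r = fshift q) p -> provable G (All p)
| prv_allE n (G : formula L n -> Prop) (p : formula L n.+1) t :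
    provable G (All p) -> provable G (finst p t)
| prv_refl n (G : formula L n -> Prop) t : provable G (Eq t t)
| prv_leibniz n (G : formula L n -> Prop) (p : formula L n.+1) t u :
    provable G (Eq t u) -> provable G (finst p t) -> provable G (finst p u).

Definition consistent L n (G : formula L n -> Prop) := ~ provable G Bot.

(* Total recursive functions: the closure of the initial functions under     *)
(* composition, primitive recursion and minimization of regular functions.   *)
Inductive recursive_fun : forall n, (('I_n -> nat) -> nat) -> Prop :=
| rec_zero n : recursive_fun (fun _ : 'I_n -> nat => 0%N)
| rec_succ : recursive_fun (fun x : 'I_1 -> nat => (x ord0).+1)
| rec_proj n (i : 'I_n) : recursive_fun (fun x => x i)
| rec_comp n m (g : ('I_m -> nat) -> nat) (h : 'I_m -> ('I_n -> nat) -> nat) :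
    recursive_fun g -> (forall i, recursive_fun (h i)) ->
    recursive_fun (fun x => g (fun i => h i x))
| rec_primrec n (g : ('I_n -> nat) -> nat) (h : ('I_n.+2 -> nat) -> nat)
    (f : ('I_n.+1 -> nat) -> nat) :
    recursive_fun g -> recursive_fun h ->
    (forall x, f (scons 0%N x) = g x) ->
    (forall y x, f (scons y.+1 x) = h (scons y (scons (f (scons y x)) x))) ->
    recursive_fun f
| rec_min n (g : ('I_n.+1 -> nat) -> nat) (f : ('I_n -> nat) -> nat) :
    recursive_fun g ->
    (forall x, g (scons (f x) x) = 0%N) ->
    (forall x y, (y < f x)%N -> g (scons y x) <> 0%N) ->
    recursive_fun f.

Definition recursive_set (A : nat -> Prop) :=
  exists2 f : ('I_1 -> nat) -> nat, recursive_fun f &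
    forall m, f (fun=> m) = nat_of_bool `[< A m >].

(* Goedel numbers; [CodeSeq.code] is the bijection of seq nat with nat       *)
(* sending a :: s to 2 ^ a * (2 * code s + 1). The numbering of the finitely *)
(* many symbols by [enum_rank] is immaterial.                                *)
Fixpoint tcode L n (t : term L n) : nat :=
  match t with
  | Var i => CodeSeq.code [:: 0%N; nat_of_ord i]
  | App f args => CodeSeq.code
      (1%N :: nat_of_ord (enum_rank f) ::
       [seq tcode (args i) | i <- enum 'I_(fary f)])
  end.

Fixpoint fcode L n (p : formula L n) : nat :=
  match p with
  | Bot _ => CodeSeq.code [:: 0%N]
  | Eq _ t u => CodeSeq.code [:: 1%N; tcode t; tcode u]
  | Rel _ r args => CodeSeq.code
      (2%N :: nat_of_ord (enum_rank r) ::
       [seq tcode (args i) | i <- enum 'I_(rary r)])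
  | Imp _ p q => CodeSeq.code [:: 3%N; fcode p; fcode q]
  | All _ p => CodeSeq.code [:: 4%N; fcode p]
  end.

Definition recursive_theory L n (T : formula L n -> Prop) :=
  recursive_set (fun m => exists2 p, T p & fcode p = m).

(* The languages containing L are, up to renaming, those obtained by adding  *)
(* to L the symbols of another language E.                                   *)
Definition lang_add (L E : language) : language :=
  @Language (fsym L + fsym E)%type
    (fun f => match f with inl f => fary f | inr f => fary f end)
    (rsym L + rsym E)%type
    (fun r => match r with inl r => rary r | inr r => rary r end).

Fixpoint tembed L E n (t : term L n) : term (lang_add L E) n :=
  match t with
  | Var i => Var i
  | App f args =>
      App (L := lang_add L E) (inl f) (fun i => tembed E (args i))
  end.

Fixpoint fembed L E n (p : formula L n) : formula (lang_add L E) n :=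
  match p with
  | Bot _ => Bot
  | Eq _ t u => Eq (tembed E t) (tembed E u)
  | Rel _ r args =>
      Rel (L := lang_add L E) (inl r) (fun i => tembed E (args i))
  | Imp _ p q => Imp (fembed E p) (fembed E q)
  | All _ p => All (fembed E p)
  end.

Definition expansion L E D (K : structure L D) (J : structure E D) :
    structure (lang_add L E) D :=
  @Structure (lang_add L E) D
    (fun f => match f return ('I_(fary (l := lang_add L E) f) -> D) -> D with
              | inl f => @ifun L D K f | inr f => @ifun E D J f end)
    (fun r => match r return ('I_(rary (l := lang_add L E) r) -> D) -> _ with
              | inl r => @irel L D K r | inr r => @irel E D J r end).

(* Th(K, a), with the free variables as names for the entries of a. *)
Definition Th L D (K : structure L D) k (a : 'I_k -> D) :
    formula L k -> Prop := fun p =>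
  sat K p a.

Definition resplendent L D (K : structure L D) :=
  forall (E : language) (k : nat) (T : formula (lang_add L E) k -> Prop)
         (a : 'I_k -> D),
    recursive_theory T ->
    consistent (fun p => T p \/ exists2 q, Th K a q & p = fembed E q) ->
    exists J : structure E D, forall p, T p -> sat (expansion K J) p a.

Variant arith_fun := AZero | AOne | AAdd | AMul.

Definition arith_fun_enc (f : arith_fun) : 'I_4 :=
  match f with
  | AZero => inord 0 | AOne => inord 1 | AAdd => inord 2 | AMul => inord 3
  end.
Definition arith_fun_dec (i : 'I_4) : arith_fun :=
  nth AZero [:: AZero; AOne; AAdd; AMul] i.
Lemma arith_fun_encK : cancel arith_fun_enc arith_fun_dec.
Proof. by case; rewrite /arith_fun_dec /= inordK. Qed.
HB.instance Definition _ := Finite.copy arith_fun (can_type arith_fun_encK).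

Definition L_arith : language :=
  @Language arith_fun
    (fun f => match f with AZero | AOne => 0 | AAdd | AMul => 2 end)%N
    unit (fun=> 2%N).

Section ArithTerms.
Variable n : nat.
Implicit Types s t : term L_arith n.
Definition azero : term L_arith n := App (L := L_arith) AZero (tnth [tuple]).
Definition aone : term L_arith n := App (L := L_arith) AOne (tnth [tuple]).
Definition aadd s t := App (L := L_arith) AAdd (tnth [tuple s; t]).
Definition amul s t := App (L := L_arith) AMul (tnth [tuple s; t]).
Definition alt s t : formula L_arith n :=
  Rel (L := L_arith) tt (tnth [tuple s; t]).
End ArithTerms.
Arguments azero {n}.
Arguments aone {n}.

(* The step p(x) -> p(x + 1) of the induction scheme, x being variable 0. *)
Definition ind_step n (p : formula L_arith n.+1) : formula L_arith n.+1 :=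
  Imp p (fsubst p (scons (aadd (Var ord0) aone)
                         (fun i => Var (lift ord0 i)))).

(* Free variables of an axiom stand for universally quantified ones, see     *)
(* [models_PA]. The usual properties of the order and of addition and        *)
(* multiplication follow by induction.                                       *)
Inductive PA_axiom : forall n, formula L_arith n -> Prop :=
| PA_succ_neq0 : let x := Var (ord0 : 'I_1) in
    PA_axiom (Neg (Eq (aadd x aone) azero))
| PA_succ_inj : let x := Var (ord0 : 'I_2) in let y := Var (ord_max : 'I_2) in
    PA_axiom (Imp (Eq (aadd x aone) (aadd y aone)) (Eq x y))
| PA_add0 : let x := Var (ord0 : 'I_1) in
    PA_axiom (Eq (aadd x azero) x)
| PA_addS : let x := Var (ord0 : 'I_2) in let y := Var (ord_max : 'I_2) in
    PA_axiom (Eq (aadd x (aadd y aone)) (aadd (aadd x y) aone))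
| PA_mul0 : let x := Var (ord0 : 'I_1) in
    PA_axiom (Eq (amul x azero) azero)
| PA_mulS : let x := Var (ord0 : 'I_2) in let y := Var (ord_max : 'I_2) in
    PA_axiom (Eq (amul x (aadd y aone)) (aadd (amul x y) x))
| PA_lt : let x := Var (ord0 : 'I_2) in let y := Var (ord_max : 'I_2) in
    PA_axiom (Iff (alt x y)
      (Exi (Eq (aadd (tshift x) (aadd (Var ord0) aone)) (tshift y))))
| PA_induction n (p : formula L_arith n.+1) :
    PA_axiom (Imp (finst p azero) (Imp (All (ind_step p)) (All p))).

Definition models_PA D (N : structure L_arith D) :=
  forall n (p : formula L_arith n), PA_axiom p -> forall v, sat N p v.

Definition nonneg (A : realDomainType) : Type := {x : A | 0 <= x}.

Section Nonneg.
Variable A : realDomainType.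
Implicit Types x y : nonneg A.
Definition nonneg0 : nonneg A := exist _ 0 (lexx 0).
Definition nonneg1 : nonneg A := exist _ 1 ler01.
Definition nonnegD x y : nonneg A :=
  exist _ (val x + val y) (addr_ge0 (valP x) (valP y)).
Definition nonnegM x y : nonneg A :=
  exist _ (val x * val y) (mulr_ge0 (valP x) (valP y)).

Definition nonneg_le : rel (nonneg A) := fun x y => val x <= val y.

Definition nonneg_structure : structure L_arith (nonneg A) :=
  @Structure L_arith (nonneg A)
    (fun f => match f return ('I_(fary (l := L_arith) f) -> nonneg A) -> _ with
              | AZero => fun=> nonneg0
              | AOne => fun=> nonneg1
              | AAdd => fun v => nonnegD (v ord0) (v ord_max)
              | AMul => fun v => nonnegM (v ord0) (v ord_max)
              end)
    (fun _ (v : 'I_2 -> nonneg A) => val (v ord0) < val (v ord_max)).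
End Nonneg.

Definition initial_segment T (le : rel T) (S : set T) :=
  forall x y, S y -> le x y -> S x.

Definition omega1_like T (le : rel T) :=
  ~ countable [set: T] /\
  forall S : set T, initial_segment le S -> S <> [set: T] -> countable S.

(* The order of the fraction field is the only one extending that of A, so   *)
(* that preserving the latter amounts to preserving the former.              *)
Definition is_real_closure (A : realDomainType) (K : rcfType)
    (i : {rmorphism {fraction A} -> K}) :=
  {mono (fun x : A => i (tofrac x)) : x y / x <= y} /\
  forall u : K, algebraicOver i u.

Variant field_fun := FZero | FOne | FAdd | FOpp | FMul.

Definition field_fun_enc (f : field_fun) : 'I_5 :=
  match f with
  | FZero => inord 0 | FOne => inord 1 | FAdd => inord 2
  | FOpp => inord 3 | FMul => inord 4
  end.
Definition field_fun_dec (i : 'I_5) : field_fun :=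
  nth FZero [:: FZero; FOne; FAdd; FOpp; FMul] i.
Lemma field_fun_encK : cancel field_fun_enc field_fun_dec.
Proof. by case; rewrite /field_fun_dec /= inordK. Qed.
HB.instance Definition _ := Finite.copy field_fun (can_type field_fun_encK).

Definition L_ofield : language :=
  @Language field_fun
    (fun f => match f with
              | FZero | FOne => 0 | FOpp => 1 | FAdd | FMul => 2 end)%N
    unit (fun=> 2%N).

Definition ofield_structure (K : realFieldType) : structure L_ofield K :=
  @Structure L_ofield K
    (fun f => match f return ('I_(fary (l := L_ofield) f) -> K) -> K with
              | FZero => fun=> 0
              | FOne => fun=> 1
              | FAdd => fun v => v ord0 + v ord_max
              | FOpp => fun v => - v ord0
              | FMul => fun v => v ord0 * v ord_max
              end)
    (fun _ (v : 'I_2 -> K) => v ord0 < v ord_max).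

(* Main.v *)
(* The model M of Peano Arithmetic is an integer part of its real closure K   *)
(* (Shepherdson), so that a subset of [0, a] whose points are at distance at  *)
(* least 1 from each other injects into {m in M | m <= a}, which is countable *)
(* if M is omega_1-like. Let a be infinite: no such subset is the image of an *)
(* injection of K into itself. But such an injection exists in a countable    *)
(* elementary substructure of K containing a, since it contains the natural   *)
(* numbers, which lie below a; if K were resplendent, there would thus be one *)
(* in K.                                                                      *)
Require Import Defs.
From mathcomp Require Import all_boot all_order all_algebra.
From mathcomp Require Import ring polyrcf.
From mathcomp Require Import boolp classical_sets functions cardinality.

Set Implicit Arguments.
Unset Strict Implicit.
Unset Printing Implicit Defensive.

Import Order.TTheory GRing.Theory Num.Theory.
Local Open Scope ring_scope.

(** The theory contradicting resplendence is one sentence [spaced_fm] about a new unary function and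
    an infinite parameter a. By [soundness], one model gives its consistency ([consistent_spaced]):
    in the countable elementary substructure from [lowenheim_skolem], the elements are numbered and
    sent to the corresponding numerals, all below a. A resplendent K would carry a map f with values
    in [0, a] at mutual distance at least 1. Nonnegative roots of polynomials over M have floors in
    M ([floor_root]), and spaced values have distinct floors, so M would inject into its countable
    segment up to a. A root without a floor would define, through a polynomial inequality, a cut of
    M violating [PA_poly_ind]. *)

(** * Semantics of substitution, soundness and expansions *)

Lemma scons0 T n (a : T) (v : 'I_n -> T) : scons a v ord0 = a.
Proof. by rewrite /scons unlift_none. Qed.

Lemma sconsS T n (a : T) (v : 'I_n -> T) i : scons a v (lift ord0 i) = v i.
Proof. by rewrite /scons liftK. Qed.

Lemma scons_comp T U (f : T -> U) n (a : T) (v : 'I_n -> T) :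
  f \o scons a v = scons (f a) (f \o v).
Proof. by apply/funext => i; rewrite /scons /=; case: unlift. Qed.

Lemma teval_tsubst L D (S : structure L D) n m (s : 'I_n -> term L m) v t :
  teval S v (tsubst s t) = teval S (fun i => teval S v (s i)) t.
Proof.
by elim: t => //= f args IH; congr ifun; apply/funext => i; apply: IH.
Qed.

Lemma teval_tshift L D (S : structure L D) n d v (t : term L n) :
  teval S (scons d v) (tshift t) = teval S v t.
Proof.
rewrite teval_tsubst; congr teval; apply/funext => i.
by rewrite /= sconsS.
Qed.

Lemma sat_fsubst L D (S : structure L D) n (p : formula L n) m
    (s : 'I_n -> term L m) v :
  sat S (fsubst p s) v = sat S p (fun i => teval S v (s i)).
Proof.
elim: p m s v => {n} //= [n t u|n r args|n p IHp q IHq|n p IHp] m s v.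
- by rewrite !teval_tsubst.
- by congr irel; apply/funext => i; rewrite teval_tsubst.
- by rewrite IHp IHq.
- apply: eq_forall => d; rewrite IHp; congr sat; apply/funext => i.
  rewrite /under_binder /scons; case: unliftP => [j|] _ /=.
    exact: teval_tshift.
  by rewrite unlift_none.
Qed.

Lemma sat_fshift L D (S : structure L D) n (p : formula L n) d v :
  sat S (fshift p) (scons d v) = sat S p v.
Proof.
by rewrite sat_fsubst; congr sat; apply/funext => i; rewrite /= sconsS.
Qed.

Lemma sat_finst L D (S : structure L D) n (p : formula L n.+1) t v :
  sat S (finst p t) v = sat S p (scons (teval S v t) v).
Proof.
rewrite sat_fsubst; congr sat; apply/funext => i.
by rewrite /scons; case: unlift.
Qed.

Lemma soundness L D (S : structure L D) n (G : formula L n -> Prop) p :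
  provable G p -> forall v, (forall q, G q -> sat S q v) -> sat S p v.
Proof.
elim=> {n G p} /=.
- by move=> n G p Gp v; apply.
- move=> n G p q _ IH v vG vp; apply: IH => r [/vG//|-> //].
- by move=> n G p q _ IHpq _ IHp v vG; apply: IHpq (IHp v vG).
- by move=> n G p _ IH v vG; apply: contrapT; apply: IH.
- move=> n G p _ IH v vG d; apply: IH => _ [q /vG vq ->].
  by rewrite sat_fshift.
- by move=> n G p t _ IH v vG; rewrite sat_finst; apply: IH.
- by [].
- move=> n G p t u _ IHtu _ IHp v vG.
  by rewrite sat_finst -(IHtu _ vG) -sat_finst; apply: IHp.
Qed.

Lemma teval_expansion L E D (K : structure L D) (J : structure E D) n v
    (t : term L n) :
  teval (expansion K J) v (tembed E t) = teval K v t.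
Proof. by elim: t => //= f args IH; congr ifun; apply/funext => i. Qed.

Lemma sat_expansion L E D (K : structure L D) (J : structure E D) n
    (p : formula L n) v :
  sat (expansion K J) (fembed E p) v = sat K p v.
Proof.
elim: p v => {n} //= [n t u|n r args|n p IHp q IHq|n p IHp] v.
- by rewrite !teval_expansion.
- by congr irel; apply/funext => i; rewrite teval_expansion.
- by rewrite IHp IHq.
- by apply: eq_forall.
Qed.

(** * Goedel numbers and countable elementary substructures *)

Lemma code_inj : injective CodeSeq.code.
Proof. exact: can_inj CodeSeq.codeK. Qed.

Local Arguments CodeSeq.code : simpl never.

Lemma tcode_inj L n : injective (@tcode L n).
Proof.
elim=> [i|f args IH] [j|g args'] /= /code_inj [] //.
  by move=> /val_inj ->.
move=> /val_inj/enum_rank_inj fg; subst g => /eq_in_map e.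
by congr App; apply/funext => i; apply/IH/e; rewrite mem_enum.
Qed.

(** Codes do not record the number of free variables, so the equality [e] is assumed; with n and m
    distinct variables, both formulas can be analysed by cases, and the induction passes under
    [All]. *)
Lemma fcode_ecast_inj L n (p : formula L n) m (q : formula L m) (e : n = m) :
  fcode p = fcode q -> ecast k (formula L k) e p = q.
Proof.
elim: p m q e => {n} [n|n t u|n r args|n p IHp q IHq|n p IHp] m
  [k|k t' u'|k r' args'|k p' q'|k p'] e /code_inj // fE; subst => //=; case: fE.
- by move=> /tcode_inj -> /tcode_inj ->.
- move=> /val_inj/enum_rank_inj rr; subst r' => /eq_in_map e.
  congr Rel; apply/funext => i.
  by apply/tcode_inj/e; rewrite mem_enum.
- by move=> /(IHp _ _ erefl) /= <- /(IHq _ _ erefl) /= <-.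
- by move=> /(IHp _ _ erefl) /= <-.
Qed.

Lemma fcode_inj L n : injective (@fcode L n).
Proof. by move=> p q /(fcode_ecast_inj erefl). Qed.

(* The substructure consists of the values of the terms built from a and the *)
(* witness functions of all formulas, a countable set since the formulas and *)
(* the trees of such terms are coded by natural numbers.                     *)
Lemma tarski_vaught_closure L D (K : structure L D) (a : D) :
  exists S : set D, [/\ S a, countable S &
    forall n (p : formula L n.+1) v, (forall i, S (v i)) ->
      (exists d, sat K p (scons d v)) ->
      exists2 d, S d & sat K p (scons d v)].
Proof.
pose P (cs : nat * seq D) d := exists n (p : formula L n.+1),
  [/\ size cs.2 = n, fcode p = cs.1 &
      sat K p (scons d (fun i => nth a cs.2 i))].
have /boolp.choice[wit witP] :
    forall cs, exists y, (exists d, P cs d) -> P cs y => [cs|].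
  by have [[d Pd]|nP] := pselect (exists d, P cs d); [exists d | exists a].
pose ev := fix ev (t : GenTree.tree nat) : D :=
  if t is GenTree.Node c ts then wit (c, map ev ts) else a.
exists (range ev); split.
- by exists (GenTree.Leaf 0%N).
- exact: card_le_trans (card_image_le _ _) (countableP _).
- move=> n p v Sv [d pd].
  have [t tv] := boolp.choice (fun i => let: ex_intro2 t _ e := Sv i in
                   ex_intro (fun t => ev t = v i) t e).
  have nthv : (fun i : 'I_n =>
      nth a [seq ev t | t <- map t (enum 'I_n)] i) = v.
    apply/funext => i.
    by rewrite -map_comp (nth_map i) ?size_enum_ord // nth_ord_enum /= tv.
  have szv : size [seq ev t | t <- map t (enum 'I_n)] = n.
    by rewrite 2!size_map size_enum_ord.
  exists (ev (GenTree.Node (fcode p) [seq t i | i <- enum 'I_n])).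
    by eexists.
  have [|n' [p' [/= sz]]] :=
    witP (fcode p, [seq ev t | t <- map t (enum 'I_n)]).
    by exists d, n, p; rewrite /= nthv.
  (* The length of the parameter list recovers the arity, which the code alone does not. *)
  have e : n' = n by rewrite -sz.
  by clear sz; subst n' => /fcode_inj ->; rewrite nthv.
Qed.

Lemma lowenheim_skolem L D (K : structure L D) (a : D) :
  exists (D0 : Type) (K0 : structure L D0) (e : D0 -> D),
    [/\ exists g : D0 -> nat, injective g, exists a0, e a0 = a,
        forall f args, e (ifun K0 (f := f) args) = ifun K (e \o args),
        forall r args, irel K0 (r := r) args = irel K (e \o args) &
        forall n (p : formula L n) v, sat K0 p v = sat K p (e \o v)].
Proof.
have [S [Sa Scount SP]] := tarski_vaught_closure K a.
pose e (x : {x | S x}) := sval x.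
have e_inj : injective e.
  by move=> x y; apply: eq_sig_hprop => ?; apply: Prop_irrelevance.
have fun_closed (f : Defs.fsym L) (args : 'I_(fary f) -> {x | S x}) :
    exists y, e y = ifun K (e \o args).
  (* The equation x = f(args) has a single solution, so its witness in [S] is the value of f. *)
  have [] := SP _ (Eq (Var ord0) (App f (fun i => Var (lift ord0 i))))
    (e \o args).
  - by move=> i; apply: (svalP (args i)).
  - by exists (ifun K (e \o args)) => /=; rewrite scons0; congr ifun;
      apply/funext => i; rewrite sconsS.
  - move=> d Sd /=; rewrite scons0 => d_eq; exists (exist _ d Sd).
    by rewrite /= d_eq; congr ifun; apply/funext => i; rewrite sconsS.
pose K0 := Structure
  (fun f args => sval (cid (fun_closed f args)))
  (fun r args => @irel L D K r (e \o args)).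
have teval_e n v (t : term L n) : e (teval K0 v t) = teval K (e \o v) t.
  elim: t => //= f args IH; case: cid => y /= ->.
  by congr ifun; apply/funext => i; apply: IH.
exists {x | S x}, K0, e; split.
- have /countable_injP[g g_inj] := Scount.
  exists (g \o e) => x y /= /g_inj gxy; apply: e_inj; apply: gxy;
  by rewrite inE; apply: svalP.
- by exists (exist _ a Sa).
- by move=> f args /=; case: cid.
- by [].
move=> n p; elim: p => {n} //= [n t u|n r args|n p IHp q IHq|n p IHp] v.
- rewrite -!teval_e; apply/propext; split => [->//|]; exact: e_inj.
- by congr irel; apply/funext => i; rewrite /= teval_e.
- by rewrite IHp IHq.
- apply/propext; split=> all_p d; last first.
    by rewrite IHp scons_comp.
  apply: contrapT => np.
  have [||d' Sd' /=] := SP _ (Neg p) (e \o v); last apply.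
  - by move=> i; apply: (svalP (v i)).
  - by exists d.
  - by have := all_p (exist _ d' Sd'); rewrite IHp scons_comp.
Qed.

(** * The theory of a spaced injection *)

(** By recursion on c: the characteristic function of c + 1 vanishes at 0 and takes at y + 1 the
    value of that of c at y. *)
Lemma recursive_singleton c : recursive_set (fun m => c = m).
Proof.
exists (fun x => nat_of_bool (c == x ord0)); last first.
  by move=> m; congr nat_of_bool; apply/eqP/asboolP.
have rec1 n : recursive_fun (fun _ : 'I_n -> nat => 1%N).
  exact: (rec_comp (n := n) rec_succ (fun=> rec_zero n)).
elim: c => [|c IH].
- by apply: (rec_primrec (rec1 0%N) (rec_zero 2)) => *; rewrite scons0.
- apply: (rec_primrec (rec_zero 0)
    (rec_comp (n := 2) (h := fun _ x => x ord0) IH (fun=> rec_proj ord0))) => *;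
  by rewrite !scons0.
Qed.

Definition L_unary : language :=
  @Language unit (fun=> 1%N) void (fun v => match v with end).

Lemma sat_And L D (S : structure L D) n (p q : formula L n) v :
  sat S (And p q) v <-> sat S p v /\ sat S q v.
Proof.
split=> [npq|[vp vq] npq]; last exact: npq.
by split; apply: contrapT => nv; apply: npq.
Qed.

Section Spaced.
Local Notation L := (lang_add L_ofield L_unary).

Definition lt_fm n (s t : term L n) : formula L n :=
  Rel (L := L) (inl tt) (tnth [tuple s; t]).
Definition zero_tm n : term L n := App (L := L) (inl FZero) (tnth [tuple]).
Definition succ_tm n (s : term L n) : term L n :=
  App (L := L) (inl FAdd)
    (tnth [tuple s; App (L := L) (inl FOne) (tnth [tuple])]).
Definition fun_tm n (s : term L n) : term L n :=
  App (L := L) (inr tt) (tnth [tuple s]).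

(** The condition |f x - f y| < 1 is split into two strict inequalities; the outermost variable is
    the parameter a. *)
Definition spaced_body : formula L 3 :=
  let x := Var ord0 in let y := Var (lift ord0 ord0) in
  let a := Var (lift ord0 (lift ord0 ord0)) in
  And (And (Neg (lt_fm (fun_tm x) (zero_tm 3))) (Neg (lt_fm a (fun_tm x))))
    (Imp (lt_fm (fun_tm x) (succ_tm (fun_tm y)))
      (Imp (lt_fm (fun_tm y) (succ_tm (fun_tm x))) (Eq x y))).

Definition spaced_fm : formula L 1 := All (All spaced_body).

(** The map [e] lets one definition serve both K, with [e] the identity, and a countable
    substructure, with [e] its inclusion. *)
Definition spaced (K : realFieldType) D (e : D -> K) (f : D -> D) (a : K) :=
  forall x y, [/\ 0 <= e (f x), e (f x) <= a &
    e (f x) < e (f y) + 1 -> e (f y) < e (f x) + 1 -> x = y].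

Lemma sat_spaced_fm (K : realFieldType) D (e : D -> K)
    (K0 : structure L_ofield D) (J : structure L_unary D) v :
  (forall f args, e (ifun K0 (f := f) args) =
     ifun (ofield_structure K) (f := f) (e \o args)) ->
  (forall r args, irel K0 (r := r) args =
     irel (ofield_structure K) (r := r) (e \o args)) ->
  sat (expansion K0 J) spaced_fm v <->
  spaced e (fun x => ifun J (f := tt) (fun=> x)) (e (v ord0)).
Proof.
move=> eF eR.
have fE n w (s : term L n) : teval (expansion K0 J) w (fun_tm s) =
    ifun J (f := tt) (fun=> teval (expansion K0 J) w s).
  by congr (ifun J); apply/funext => i; rewrite ord1.
have impE n (p q : formula L n) w : sat (expansion K0 J) (Imp p q) w =
    (sat (expansion K0 J) p w -> sat (expansion K0 J) q w) by [].
have negE n (p : formula L n) w : sat (expansion K0 J) (Neg p) w =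
    ~ sat (expansion K0 J) p w by [].
have eqE n (s t : term L n) w : sat (expansion K0 J) (Eq s t) w =
    (teval (expansion K0 J) w s = teval (expansion K0 J) w t) by [].
have ltE n w (s t : term L n) : sat (expansion K0 J) (lt_fm s t) w =
    (e (teval (expansion K0 J) w s) < e (teval (expansion K0 J) w t)).
  by rewrite /= eR /=.
have succE n w (s : term L n) : e (teval (expansion K0 J) w (succ_tm s)) =
    e (teval (expansion K0 J) w s) + 1.
  by rewrite /= eF /= eF.
have zeroE n w : e (teval (expansion K0 J) w (zero_tm n)) = 0.
  by rewrite /= eF.
set f := fun x => ifun J _.
have bodyE x y : let w := scons y (scons x v) in
    [/\ teval (expansion K0 J) w (Var ord0) = y,
      teval (expansion K0 J) w (Var (lift ord0 ord0)) = x &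
      teval (expansion K0 J) w (Var (lift ord0 (lift ord0 ord0))) = v ord0].
  by rewrite /= !sconsS !scons0.
rewrite (_ : sat _ _ _ = forall x y,
  sat (expansion K0 J) spaced_body (scons y (scons x v))) //.
split=> fP x y; have [xE yE aE] := bodyE y x.
- have /sat_And[/sat_And[f0 fa] fxy] := fP y x.
  split.
  + by rewrite leNgt; apply/negP; move: f0; rewrite negE ltE fE xE zeroE.
  + by rewrite leNgt; apply/negP; move: fa; rewrite negE ltE fE xE aE.
  + move: fxy; rewrite !impE !ltE eqE !succE !fE xE yE; exact.
- have {xE yE aE} [xE yE aE] := bodyE x y; have [fy0 fya fyx] := fP y x.
  apply/sat_And; split; first (apply/sat_And; split).
  + by rewrite negE ltE fE xE zeroE ltNge fy0.
  + by rewrite negE ltE fE xE aE ltNge fya.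
  + by rewrite !impE !ltE eqE !succE !fE xE yE; exact.
Qed.

Lemma consistent_spaced (K : realFieldType) (a : K) :
  (forall n, n%:R <= a) ->
  consistent (fun p => p = spaced_fm \/
    exists2 q, Th (ofield_structure K) (fun _ : 'I_1 => a) q &
               p = fembed L_unary q).
Proof.
move=> a_inf /soundness contra.
have [D0 [K0 [e [[g g_inj] [a0 a0E] eF eR eS]]]] :=
  lowenheim_skolem (ofield_structure K) a.
have /boolp.choice[nat_e nat_eE] : forall n, exists x, e x = n%:R.
  elim=> [|n [x xE]].
    by exists (ifun K0 (f := FZero) (tnth [tuple])); rewrite eF.
  pose one := ifun K0 (f := FOne) (tnth [tuple]).
  exists (ifun K0 (f := FAdd) (tnth [tuple x; one])).
  by rewrite eF /= xE (_ : e one = 1) ?natr1 // /one eF.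
pose J := @Structure L_unary D0 (fun _ args => nat_e (g (args ord0)))
  (fun _ _ => False).
apply: (contra D0 (expansion K0 J) (fun=> a0)) => p [->|[q qa ->]].
- apply/(sat_spaced_fm _ _ eF eR) => x y /=.
  rewrite a0E !nat_eE a_inf ler0n; split => //.
  by rewrite !natr1 !ltr_nat !ltnS => xy yx; apply: g_inj; apply/anti_leq/andP.
- rewrite sat_expansion eS (_ : e \o _ = fun=> a) //.
  by apply/funext => i /=.
Qed.

Lemma resplendent_spaced (K : realFieldType) (a : K) :
  (forall n, n%:R <= a) -> resplendent (ofield_structure K) ->
  exists f : K -> K, spaced id f a.
Proof.
move=> a_inf /(_ L_unary 1%N (fun p => p = spaced_fm) (fun=> a)) [].
- have [f f_rec fE] := recursive_singleton (fcode spaced_fm).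
  exists f => // m; rewrite fE; congr nat_of_bool; apply: asbool_equiv_eq.
  by split=> [<-|[_ -> //]]; exists spaced_fm.
- exact: consistent_spaced.
- move=> J /(_ _ erefl) /(sat_spaced_fm _ _ (e := id)) J_spaced.
  by eexists; apply: J_spaced.
Qed.
End Spaced.

(** * Induction in M for polynomial inequalities *)

Section PeanoArithmetic.
Variable M : realDomainType.
Hypothesis M_PA : models_PA (nonneg_structure M).
Local Notation N := (nonneg_structure M).

Lemma PA_ind (P : M -> Prop) n (q : formula L_arith n.+1)
    (v : 'I_n -> nonneg M) :
  (forall x : nonneg M, P (val x) <-> sat N q (scons x v)) ->
  P 0 -> (forall x, 0 <= x -> P x -> P (x + 1)) -> forall x, 0 <= x -> P x.
Proof.
move=> Pq P0 PS x x_ge0; apply/(Pq (exist _ x x_ge0)).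
have ind : sat N (finst q azero) v ->
    (forall y, sat N (ind_step q) (scons y v)) ->
    forall y, sat N q (scons y v) := M_PA (PA_induction q) v.
apply: ind => [|y]; first by rewrite sat_finst -Pq.
move=> /Pq/(PS _ (valP y)) Py1; rewrite sat_fsubst.
rewrite [X in sat N q X](_ : _ = scons (nonnegD y (nonneg1 M)) v) -?Pq //.
apply/funext => i; rewrite /scons; case: unliftP => [k|] _ /=; rewrite /scons.
  by rewrite liftK.
by rewrite unlift_none.
Qed.

(** Induction on the formula y < 1 -> y = 0; its step is vacuous, as y + 1 < 1 fails for y >= 0. *)
Lemma PA_ge1 (x : M) : 0 < x -> 1 <= x.
Proof.
move=> x_gt0; rewrite leNgt; apply/negP => x_lt1.
suff : x < 1 -> x = 0 by move=> /(_ x_lt1) x0; rewrite x0 ltxx in x_gt0.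
apply: (@PA_ind (fun y => y < 1 -> y = 0) 0
  (Imp (alt (Var ord0) aone) (Eq (Var ord0) azero)) (tnth [tuple])) => //=;
  last 2 first.
- by move=> y y_ge0 _; rewrite gtrDr ltNge y_ge0.
- exact: ltW.
move=> y; rewrite !scons0; split=> [H /H y0|H /H ->//]; exact: val_inj.
Qed.

(** Horner's scheme, [s] listing the variables that hold the coefficients, so that these enter a
    formula as parameters. *)
Definition horner_tm n (s : seq 'I_n) : term L_arith n.+1 :=
  foldr (fun i t => aadd (amul t (Var ord0)) (Var (lift ord0 i))) azero s.

Lemma teval_horner_tm n (s : seq 'I_n) x (v : 'I_n -> nonneg M) :
  val (teval N (scons x v) (horner_tm s)) =
  (Poly [seq val (v i) | i <- s]).[val x].
Proof.
rewrite horner_Poly; elim: s => //= i s IH.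
by rewrite IH scons0 sconsS.
Qed.

(** Formulas of arithmetic speak of nonnegative elements only. Hence p is written as a difference of
    two polynomials with nonnegative coefficients, and p(x) <= 0 compares the values of two
    terms. *)
Lemma PA_poly_ind (p : {poly M}) (b c : M) (P : M -> Prop) :
  0 <= b -> 0 <= c ->
  (forall x, 0 <= x -> P x <-> (~~ (x < b) -> (x < c) && (p.[x] <= 0))) ->
  P 0 -> (forall x, 0 <= x -> P x -> P (x + 1)) -> forall x, 0 <= x -> P x.
Proof.
move=> b_ge0 c_ge0 PE.
pose part (e : bool) k := Num.max ((-1) ^+ e * p`_k) 0.
have part_ge0 e k : 0 <= part e k by rewrite le_max lexx orbT.
(* The parameters: b ([inl true]), c ([inl false]) and the coefficients of both parts. *)
pose I : finType := (bool + bool * 'I_(size p))%type.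
pose w (a : I) : nonneg M := match a with
  | inl e => if e then exist _ b b_ge0 else exist _ c c_ge0
  | inr (e, k) => exist _ (part e k) (part_ge0 e k) end.
pose v (j : 'I_#|I|) := w (enum_val j).
pose var a : term L_arith #|I|.+1 := Var (lift ord0 (enum_rank (a : I))).
pose ptm e :=
  horner_tm [seq enum_rank (inr (e, k) : I) | k <- enum 'I_(size p)].
pose r1 := alt (Var ord0) (var (inl false)).
pose r2 := Neg (alt (ptm true) (ptm false)).
pose q := Imp (Neg (alt (Var ord0) (var (inl true)))) (And r1 r2).
have varE x a : val (teval N (scons x v) (var a)) = val (w a).
  by rewrite /= sconsS /v enum_rankK.
have ptmE x e : val (teval N (scons x v) (ptm e)) =
    (\poly_(k < size p) part e k).[val x].
  rewrite teval_horner_tm -map_comp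
    (_ : map _ _ = mkseq (part e) (size p)); last first.
    rewrite /mkseq -val_enum_ord -map_comp; apply: eq_map => k /=.
    by rewrite /v enum_rankK.
  congr horner; apply/polyP => k; rewrite coef_Poly coef_poly.
  case: ltnP => k_p; first by rewrite nth_mkseq.
  by rewrite nth_default ?size_mkseq.
have pE : p = \poly_(k < size p) part false k - \poly_(k < size p) part true k.
  apply/polyP => k; rewrite coefB !coef_poly.
  case: ltnP => [_|/(nth_default 0) ->].
    rewrite /part /= expr0 expr1 mul1r mulN1r.
    case: (lerP 0 p`_k) => [pk|/ltW pk].
      by rewrite max_r ?oppr_le0 // subr0.
    by rewrite max_l ?oppr_ge0 // sub0r opprK.
  by rewrite subr0.
apply: (PA_ind (q := q) (v := v)) => x.
have {}varE a : val (teval N (scons x v) (var a)) = val (w a) := varE x a.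
have x0 : teval N (scons x v) (Var ord0) = x by apply: scons0.
have -> : sat N q (scons x v) <->
  (~ (val (teval N (scons x v) (Var ord0)) <
      val (teval N (scons x v) (var (inl true)))) ->
   val (teval N (scons x v) (Var ord0)) <
     val (teval N (scons x v) (var (inl false))) /\
   ~ (val (teval N (scons x v) (ptm true)) <
      val (teval N (scons x v) (ptm false)))).
  split=> H xb; last by apply: (proj2 (sat_And N r1 r2 (scons x v))); apply: H.
  by apply: (proj1 (sat_And N r1 r2 (scons x v))); apply: H.
rewrite x0; clear x0.
rewrite !varE !ptmE PE ?(valP x) //.
have -> := congr1 (horner^~ (val x)) pE; rewrite hornerD hornerN subr_le0.
rewrite (leNgt _.[val x]).
split=> [H /negP/H/andP[-> /negP]//|H /negP/H[-> H2]].
exact/negP.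
Qed.

(** * Floors in M of roots of polynomials *)

Section Floor.
Variables (K : rcfType) (j : {rmorphism M -> K}).
Hypothesis j_mono : {mono j : x y / x <= y}.

Let j_lt : {mono j : x y / x < y} := leW_mono j_mono.
Let j_inj : injective j := inc_inj j_mono.
Let j_ge0 x : (0 <= j x) = (0 <= x).
Proof. by rewrite -(rmorph0 j) j_mono. Qed.
Let j_norm x : j `|x| = `|j x|.
Proof.
by have [x0|x0] := ger0P x; [rewrite ger0_norm ?j_ge0 |
  rewrite ltr0_norm ?rmorphN // -(rmorph0 j) j_lt].
Qed.

Lemma root_lt_PA (p : {poly M}) x : p != 0 -> root (map_poly j p) x ->
  exists2 c, 0 <= c & x < j c.
Proof.
move=> p0 px; exists (1 + \sum_(i < size p) `|p`_i|).
  by rewrite addr_ge0 ?ler01 ?sumr_ge0.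
have sz : size (map_poly j p) = size p by rewrite size_map_inj_poly ?rmorph0.
have jp0 : map_poly j p != 0 by rewrite -size_poly_eq0 sz size_poly_eq0.
apply: le_lt_trans (ler_norm x) (lt_le_trans (cauchy_boundP jp0 (rootP px)) _).
rewrite /cauchy_bound sz rmorphD rmorph1 rmorph_sum lerD2l.
under eq_bigr do rewrite coef_map -j_norm.
rewrite ler_piMl ?sumr_ge0 //; first by move=> *; rewrite j_ge0.
rewrite lead_coef_map_inj ?rmorph0 // -j_norm invf_le1.
  by rewrite -(rmorph1 j) j_mono PA_ge1 // normr_gt0 lead_coef_eq0.
by rewrite -(rmorph0 j) j_lt normr_gt0 lead_coef_eq0.
Qed.

(* If x had no floor, the derivative, whose roots have floors, would have no *)
(* root near the cut of x in M; the polynomial would then be monotone there, *)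
(* and its sign would define a proper cut of M closed under successor.       *)
Lemma floor_root (p : {poly M}) x : p != 0 -> 0 <= x -> root (map_poly j p) x ->
  exists2 m, 0 <= m & j m <= x < j m + 1.
Proof.
have [n] := ubnP (size p); elim: n p x => // n IH p x szp p0 x_ge0 px.
apply: contrapT => nofloor.
(* Were m + 1 above x, m would be the floor of x. *)
have cut_succ m : 0 <= m -> j m <= x -> j (m + 1) <= x.
  move=> m_ge0 mx; rewrite leNgt; apply/negP => xm; apply: nofloor.
  by exists m => //; rewrite mx -(rmorph1 j) -rmorphD.
have cut0 : j 0 <= x by rewrite rmorph0.
have sz : size (map_poly j p) = size p by rewrite size_map_inj_poly ?rmorph0.
have jp0 : map_poly j p != 0 by rewrite -size_poly_eq0 sz size_poly_eq0.
have szp1 : (1 < size p)%N by rewrite -sz; apply: root_size_gt1 px.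
have p'0 : p^`() != 0.
  (* This coefficient of p' is a nonzero integer multiple of the leading coefficient of p. *)
  apply/eqP => /polyP/(_ (size p).-2); rewrite coef_deriv coef0 => /eqP.
  rewrite mulrn_eq0 /= -subn2 -subSn // subSS subn1 -/(lead_coef p).
  by rewrite lead_coef_eq0 (negPf p0).
(* A floor m of r separates r from x: if m <= x, then r < m + 1 <= x by [cut_succ]; otherwise x < m
   <= r. *)
have p'_root r : root (map_poly j p^`()) r ->
    (exists2 b, 0 <= b & j b <= x /\ r < j b) \/
    (exists2 c, 0 <= c & x < j c /\ j c <= r).
  move=> pr; have [r_ge0|r_lt0] := lerP 0 r; last first.
    by left; exists 0 => //; rewrite rmorph0.
  have [|m m_ge0 /andP[mr rm]] := IH _ r _ p'0 r_ge0 pr.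
    by rewrite -ltnS (leq_trans _ szp) // ltnS lt_size_deriv.
  have [mx|xm] := lerP (j m) x; [left|right]; last by exists m.
  exists (m + 1); first by rewrite addr_ge0.
  by rewrite cut_succ // rmorphD rmorph1.
have p'_roots (rs : seq K) : all (root (map_poly j p^`())) rs ->
    exists b c, [/\ 0 <= b, 0 <= c, j b <= x, x < j c &
      forall r, r \in rs -> r < j b \/ j c <= r].
  elim: rs => [_|r rs IHrs /= /andP[/p'_root pr /IHrs[b [c [b0 c0 bx xc bc]]]]].
    by have [c c0 xc] := root_lt_PA p0 px; exists 0, c; split.
  case: pr => [[d d0 [dx rd]]|[d d0 [xd dr]]].
  - exists (Num.max b d), c; split => //; first by rewrite le_max b0.
      by case: (leP b d).
    move=> s; rewrite inE => /predU1P[->|/bc[sb|]]; last by right.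
      by left; rewrite (lt_le_trans rd) // j_mono le_max lexx orbT.
    by left; rewrite (lt_le_trans sb) // j_mono le_max lexx.
  - exists b, (Num.min c d); split => //; first by rewrite le_min c0.
      by case: (leP c d).
    move=> s; rewrite inE => /predU1P[->|/bc[|cs]]; last 2 first.
    + by left.
    + by right; rewrite (le_trans _ cs) // j_mono ge_min lexx.
    by right; rewrite (le_trans _ dr) // j_mono ge_min lexx orbT.
have jp'0 : map_poly j p^`() != 0.
  by rewrite -size_poly_eq0 size_map_inj_poly ?rmorph0 // size_poly_eq0.
have rsP r : root (map_poly j p^`()) r = (r \in rootsR (map_poly j p^`())).
  by rewrite -(roots_on_rootsR jp'0).
have [b [c [b0 c0 bx xc bc]]] : exists b c,
    [/\ 0 <= b, 0 <= c, j b <= x, x < j c &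
      forall r, root (map_poly j p^`()) r -> r < j b \/ j c <= r].
  have [|b [c [? ? ? ? bc]]] := p'_roots (rootsR (map_poly j p^`())).
    by apply/allP => r; rewrite -rsP.
  by exists b, c; split => // r; rewrite rsP; apply: bc.
have {}bx : j b < x.
  by apply: lt_le_trans (cut_succ _ b0 bx); rewrite j_lt ltrDl.
have x_in : x \in `]j b, j c[ by rewrite in_itv /= bx.
(* The derivative has constant sign on the interval, so p or -p is increasing there. *)
have [q qx q'_gt0] : exists2 q : {poly M}, root (map_poly j q) x &
    {in `]j b, j c[, forall y, 0 < (map_poly j q)^`().[y]}.
  have noroot : {in `]j b, j c[, forall y, ~~ root (map_poly j p)^`() y}.
    move=> y; rewrite in_itv /= deriv_map => /andP[by_ yc].
    apply/negP => /bc[yb|cy];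
    [have := lt_trans by_ yb | have := lt_le_trans yc cy];
    by rewrite ltxx.
  have sgE y : y \in `]j b, j c[ -> Num.sg (map_poly j p)^`().[y] =
      Num.sg (map_poly j p)^`().[x].
    by move=> y_in; apply: (polyrN0_itv noroot x_in y_in).
  have := noroot x x_in; rewrite rootE neq_lt => /orP[px0|px0].
    exists (- p); first by rewrite rmorphN rootN.
    move=> y /sgE; rewrite (ltr0_sg px0) => /eqP.
    by rewrite rmorphN derivN hornerN oppr_gt0 sgr_cp0.
  exists p => // y /sgE; rewrite (gtr0_sg px0) => /eqP.
  by rewrite sgr_cp0.
have cutE y : 0 <= y -> j y <= x <-> (~~ (y < b) -> (y < c) && (q.[y] <= 0)).
  move=> _; have [yb|by_] := ltrP y b => /=.
    by split=> // _; rewrite ltW // (lt_trans _ bx) // j_lt.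
  have [yc|cy] /= := ltrP y c; last first.
    split=> [yx|/(_ isT)//]; have := le_lt_trans yx xc.
    by rewrite j_lt ltNge cy.
  rewrite -j_mono rmorph0 -horner_map -(rootP qx).
  rewrite (ler_horner q'_gt0) ?in_itv /= ?j_mono ?by_
    ?(ltW bx) ?(ltW xc) ?(ltW yc) //.
  by split=> [|/(_ isT)].
(* The cut is definable and closed under successor, so it contains c, although x < c. *)
have := PA_poly_ind b0 c0 cutE cut0 cut_succ c0.
by rewrite leNgt xc.
Qed.

End Floor.
End PeanoArithmetic.

(** * Clearing denominators and the final count *)

Lemma fractionP (A : idomainType) (u : {fraction A}) :
  exists n d : A, d != 0 /\ u * tofrac d = tofrac n.
Proof.
elim/quotW: u => r; exists (frac r).1, (frac r).2; have d0 := denom_ratioP r.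
split=> //; unlock tofrac; rewrite -[_ * _]/(FracField.mul _ _) !piE.
apply/eqmodP; rewrite /= FracField.equivfE /FracField.mulf.
by rewrite !numden_Ratio ?mulr1 ?oner_eq0 // mulrC.
Qed.

Lemma clear_denominators (A : idomainType) (q : {poly {fraction A}}) :
  exists2 d : A, d != 0 &
    exists p : {poly A}, map_poly (@tofrac A) p = tofrac d *: q.
Proof.
elim/poly_ind: q => [|q c [d d0 [p pE]]].
  by exists 1; rewrite ?oner_neq0 //; exists 0; rewrite rmorph0 scaler0.
have [n [e [e0 cE]]] := fractionP c.
exists (d * e); first by rewrite mulf_neq0.
exists ((e *: p) * 'X + (d * n)%:P).
rewrite rmorphD rmorphM /= map_polyX map_polyC map_polyZ pE /= !tofracM -cE.
rewrite scalerDr -!scalerAl scalerA [tofrac e * _]mulrC; congr (_ + _).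
by rewrite -mul_polyC -polyCM; congr polyC; ring.
Qed.

(** Otherwise the nonnegative part would be the union over n of the segments x < n, each proper and
    hence countable. *)
Lemma omega1_like_infinite (M : realDomainType) :
  omega1_like (@nonneg_le M) -> exists2 a : M, 0 <= a & forall n, n%:R <= a.
Proof.
move=> [uncount count_seg]; apply: contrapT => no_inf; apply: uncount.
have -> : ([set: nonneg M] =
    \bigcup_(n in [set: nat]) [set x | (val x < n%:R)%R])%classic.
  apply/seteqP; split=> // x _; apply: contrapT => nx; apply: no_inf.
  exists (val x) => [|n]; first exact: valP.
  by rewrite leNgt; apply/negP => xn; apply: nx; exists n.
apply: bigcup_countable => // n _; apply: count_seg.
  by move=> x y /= yn xy; apply: le_lt_trans xy yn.
move=> /seteqP[_ /(_ (exist _ n%:R (ler0n _ n)) I)] /=.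
by rewrite ltxx.
Qed.

Theorem proposition2p1 (M : realDomainType)
    (M_PA : models_PA (nonneg_structure M))
    (M_omega1 : omega1_like (@nonneg_le M))
    (RM : rcfType) (i : {rmorphism {fraction M} -> RM})
    (RM_closure : is_real_closure i) :
  ~ resplendent (ofield_structure RM).
Proof.
have [j_mono alg] := RM_closure; pose j : {rmorphism M -> RM} := i \o @tofrac M.
have [a a_ge0 a_inf] := omega1_like_infinite M_omega1.
have {}a_inf n : n%:R <= j a by rewrite -(rmorph_nat j) [j _ <= _]j_mono.
move=> /(resplendent_spaced a_inf)[f f_spaced].
have floor u : 0 <= u -> exists2 m, 0 <= m & j m <= u < j m + 1.
  have [q q0 qu] := alg u; have [d d0 [p pE]] := clear_denominators q.
  have p0 : p != 0.
    apply: contraNneq q0 => p0; move/eqP: pE.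
    by rewrite p0 rmorph0 eq_sym scaler_eq0 tofrac_eq0 (negPf d0).
  move=> u_ge0; apply: (@floor_root M M_PA RM j j_mono p u p0 u_ge0).
  by rewrite map_poly_comp pE map_polyZ rootZ ?fmorph_eq0 ?tofrac_eq0.
have /boolp.choice[m mP] :
    forall u, exists m : nonneg M, j (val m) <= f u < j (val m) + 1.
  move=> u; have [f0 _ _] := f_spaced u u.
  by have [m m0 mu] := floor _ f0; exists (exist _ m m0).
have [uncount count_seg] := M_omega1; apply: uncount.
have /countable_injP[g g_inj] :
    countable [set x : nonneg M | val x <= a]%classic.
  apply: count_seg => [x y /= ya xy|]; first exact: le_trans xy ya.
  move=> /seteqP[_ /(_ (exist _ (a + 1) (addr_ge0 a_ge0 ler01)) I)] /=.
  by rewrite gerDl ler10.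
(* x is sent to the floor of f(x), an element of the segment up to a, which [g] numbers. *)
apply/countable_injP; exists (fun x => g (m (j (val x)))) => x y _ _ /g_inj mxy.
have m_le u : val (m u) <= a.
  have [_ fa _] := f_spaced u u; have /andP[mf _] := mP u.
  by rewrite -j_mono (le_trans mf).
have {}mxy : m (j (val x)) = m (j (val y))
  by apply: mxy; rewrite inE; apply: m_le.
apply: val_inj; apply: (inc_inj j_mono).
have [_ _ apart] := f_spaced (j (val x)) (j (val y)).
have /andP[mx xm] := mP (j (val x)); have /andP[my ym] := mP (j (val y)).
(* Equal floors put the two values of f less than 1 apart. *)
apply: apart.
  by rewrite (lt_le_trans xm) // mxy lerD2r.
by rewrite (lt_le_trans ym) // -mxy lerD2r.
Qed.
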